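(* Let $K\ge1$ and $m\ge 3K$ be integers and let $r:[0,1]^K\to\mathbb{R}$ be a smooth index invariant reward function. Then for any $\boldsymbol{\mu}\in[0,1]^K$ there exists $T_0$ such that for any horizon $T\ge T_0$ and any strategy $\psi$ there exists a CMAB problem $\underline{\nu}'$ (with $m$ base arms, actions of size $K$ and reward function $r$) that is $J$-disjoint for some $J\subset[m]$, with $\mathbb{E}[\nu'_{S^*}]=\boldsymbol{\mu}$ (the vector of means of the arms in the optimal action $S^*$ is $\boldsymbol\mu$), whose regret under strategy $\psi$ is bounded by $$\mathbb{E}_{\underline{\nu}'}[R(T)]\;\ge\;\max_{I\subsetneq[K]}\frac{\tilde\gamma_g(\boldsymbol{\mu};I)}{32}\sqrt{\frac{T(m-K)}{K_I}},\qquad K_I=K-|I|.$$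
   Context: Notation: $[n]=\{1,\dots,n\}$. CMAB problem. There are $m$ base arms. An action set $\mathcal{S}$ is a nonempty family of subsets of $[m]$, each of size exactly $K$. A CMAB problem $\underline{\nu}$ consists of an action set and a probability distribution on $[0,1]^m$ with mean vector $\boldsymbol\theta$. At each round $t$ a vector $X^{(t)}\in[0,1]^m$ is drawn from this distribution independently of other rounds; the agent chooses $S_t\in\mathcal{S}$ and observes $\{(i,X^{(t)}_i):i\in S_t\}$ (semi-bandit feedback). $\nu_S$ is the law of $(X_i^{(t)})_{i\in S}$, regarded as a law on $\mathbb{R}^K$ via an enumeration of $S$. Reward. A smooth index invariant reward function is a reward $r(S;\boldsymbol\theta)$, differentiable in $\boldsymbol\theta\in[0,1]^m$ for each action $S$, that depends only on the means of the arms in $S$: $r(S;\boldsymbol\theta)=r(\boldsymbol\theta_S)$, where $r:[0,1]^K\to\mathbb{R}$ is differentiable and does not depend on the order (symmetric in its $K$ arguments). Regret. $S^*\in\arg\max_{S\in\mathcal{S}}r(\boldsymbol\theta_S)$ is an optimal action, $\Delta_S=r(\boldsymbol\theta_{S^*})-r(\boldsymbol\theta_S)$, $R(T)=\sum_{t=1}^T\Delta_{S_t}$. Strategies. A strategy $\psi$ chooses $S_{t+1}$ as a measurable function of the past observations and of internal i.i.d. randomization $U_0,U_1,\dots\in[0,1]$ (it may know the action set and $r$ but not the distribution). $J$-disjoint. For $J\subset[m]$ a CMAB problem is $J$-disjoint if the arms in $J$ are mutually independent of the arms outside $J$, and $S_1\cap S_2=J$ for all $S_1\neq S_2\in\mathcal{S}$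 (implicitly $|J|\le K$). Modified Gini-weighted smoothness. For $\boldsymbol\mu\in[0,1]^K$ and $I\subset[K]$, let $K_I=K-|I|$ and let $p=p^{\boldsymbol\mu,I}\in[0,1]^K$ be the vector whose first $K_I$ entries are the $\mu_i$, $i\notin I$, sorted in nondecreasing order, followed by the entries $\mu_i$, $i\in I$. Then $$\tilde\gamma_g^2(\boldsymbol\mu;I)=\sum_{i=1}^{K_I}p_i(1-p_i)\big(\nabla_i r(p)\big)^2+2\sum_{i=1}^{K_I}\sum_{j=i+1}^{K_I}p_i(1-p_j)\nabla_i r(p)\nabla_j r(p).$$ This quantity is nonnegative, and $\tilde\gamma_g(\boldsymbol\mu;I)$ denotes its nonnegative square root. *)

(* Defs.v *)
From HB Require Import structures.
From mathcomp Require Import all_boot all_order all_algebra perm.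
From mathcomp Require Import all_classical all_reals all_analysis.

Set Implicit Arguments.
Unset Strict Implicit.
Unset Printing Implicit Defensive.
Import Order.TTheory GRing.Theory Num.Theory.
Import numFieldNormedType.Exports.
Local Open Scope classical_set_scope.
Local Open Scope ring_scope.

Section reward.
Context {R : realType} {K : nat}.
Implicit Types (r : 'rV[R]_K -> R) (p mu : 'rV[R]_K) (I : {set 'I_K}).

Definition cube : set 'rV[R]_K := [set p | forall i, 0 <= p ord0 i <= 1].

(* Differentiability on the closed cube is relative to the cube: the remainder
   is controlled along [within cube (nbhs p)] only, so that the values of [r]
   outside of the cube are irrelevant. As the cube is convex with nonempty
   interior, the relative differential at a point of the cube is unique. *)
Definition smooth_index_invariant r :=
  (forall p, cube p -> differentiable r (within cube (nbhs p))) /\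
  (forall p (s : 'S_K), cube p -> r (col_perm s p) = r p).

Definition grad r p (i : 'I_K) : R :=
  'd r (within cube (nbhs p)) (delta_mx ord0 i).

(* The entries indexed by [I] come last; their relative order is immaterial to
   [gini_sq], as [r] is symmetric. *)
Definition sorted_means mu I : seq R :=
  sort <=%R [seq mu ord0 i | i <- enum (~: I)] ++ [seq mu ord0 i | i <- enum I].

Definition sorted_vec mu I : 'rV[R]_K := \row_(i < K) (sorted_means mu I)`_i.

Definition gini_sq r mu I : R :=
  let p := sorted_vec mu I in
  let KI := (K - #|I|)%N in
  \sum_(i < K | (i < KI)%N) p ord0 i * (1 - p ord0 i) * grad r p i ^+ 2
  + 2 * \sum_(i < K | (i < KI)%N) \sum_(j < K | (i < j < KI)%N)
          p ord0 i * (1 - p ord0 j) * grad r p i * grad r p j.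

Definition gini r mu I : R := Num.sqrt (gini_sq r mu I).

End reward.

Record action_set (m K : nat) := ActionSet {
  actions :> {set {set 'I_m}};
  _ : actions != finset.set0;
  _ : [forall S in actions, #|S| == K] }.

Record cmab (R : realType) (m K : nat) := Cmab {
  cmab_actions : action_set m K;
  cmab_law : probability (m.-tuple R) R;
  _ : cmab_law [set x | forall i, 0 <= tnth x i <= 1] = 1%E }.

Section cmab.
Context {R : realType} {m K : nat}.
Implicit Types (nu : cmab R m K) (r : 'rV[R]_K -> R) (S J : {set 'I_m}).

Definition arm_mean nu (i : 'I_m) : R :=
  fine 'E_(cmab_law nu)[fun x => tnth x i].

(* The arms of S are listed in increasing order; rewards being symmetric, the
   order does not matter. *)
Definition action_means nu S : 'rV[R]_K :=
  \row_(i < K) [seq arm_mean nu j | j <- enum S]`_i.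

Definition reward_of r nu S : R := r (action_means nu S).

Definition optimal r nu S :=
  S \in (cmab_actions nu : {set _}) /\
  forall S', S' \in (cmab_actions nu : {set _}) ->
    reward_of r nu S' <= reward_of r nu S.

(* [mu] is the mean vector of [nu_S], seen as a law on [R^K] via an
   enumeration of S. *)
Definition has_means nu S (mu : 'rV[R]_K) :=
  exists e : 'I_K -> 'I_m,
    [/\ injective e, [set e i | i : 'I_K]%SET = S
      & forall i, arm_mean nu (e i) = mu ord0 i].

(* The coordinates outside of S are erased. *)
Definition keep S (x : m.-tuple R) : m.-tuple R :=
  [tuple if i \in S then tnth x i else 0 | i < m].

(* The sigma-algebra generated by the coordinates in J is the preimage of the
   sigma-algebra of R^m by [keep J]: the first clause is the independence
   of the vectors (X_i), i in J, and (X_i), i not in J. *)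
Definition J_disjoint nu J :=
  [/\ forall A B : set (m.-tuple R), measurable A -> measurable B ->
        cmab_law nu ((keep J @^-1` A) `&` (keep (~: J) @^-1` B)) =
        (cmab_law nu (keep J @^-1` A) *
         cmab_law nu (keep (~: J) @^-1` B))%E,
      forall S1 S2, S1 \in (cmab_actions nu : {set _}) ->
        S2 \in (cmab_actions nu : {set _}) -> S1 != S2 -> S1 :&: S2 = J
    & (#|J| <= K)%N].

End cmab.

(* [choose_action past (obs, u)] is the action of round t+1 (rounds are numbered
   from 1): [past] lists the actions S_1, ..., S_t already played, [obs] the
   observed vectors X^(1), ..., X^(t), where the unobserved coordinates are
   erased (see [keep]), and [u] is U_0, ..., U_t. As there are finitely many
   [past], measurability at fixed [past] is joint measurability. The law of
   the U_i is part of the strategy. *)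
Record policy (R : realType) (m K : nat) (A : action_set m K) := Policy {
  rand_law : probability R R;
  choose_action : forall t : nat, t.-tuple {set 'I_m} ->
    t.-tuple (m.-tuple R) * t.+1.-tuple R -> {set 'I_m};
  _ : rand_law `[0, 1]%classic = 1%E;
  _ : forall t (past : t.-tuple _) h, choose_action past h \in (A : {set _});
  _ : forall t (past : t.-tuple _) S,
    measurable (choose_action past @^-1` [set S]) }.

Definition strategy (R : realType) (m K : nat) :=
  forall A : action_set m K, policy R A.

Section iid.
Context d (T : measurableType d) (R : realType) (P : probability T R).

Let cons_tuple n (x : T * n.-tuple T) : n.+1.-tuple T :=
  [tuple of x.1 :: x.2].

Let measurable_cons_tuple n : measurable_fun setT (@cons_tuple n).
Proof. exact: measurable_cons. Qed.

HB.instance Definition _ n := isMeasurableFun.Build _ _ _ _ (@cons_tuple n)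
  (@measurable_cons_tuple n).

Fixpoint iid n : probability (n.-tuple T) R :=
  match n with
  | 0 => \d_[tuple]
  | n.+1 => distribution (P \x iid n)%E (@cons_tuple n)
  end.

End iid.

Section interaction.
Context {R : realType} {m K : nat}.

(* [u t] is U_t and [x t] is X^(t+1). *)
Section run.
Context (A : action_set m K) (pi : policy R A).
Variables (u : nat -> R) (x : nat -> m.-tuple R).

Definition next_action t (past : t.-tuple {set 'I_m}) : {set 'I_m} :=
  choose_action pi past
    ([tuple keep (tnth past i) (x i) | i < t], [tuple u i | i < t.+1]).

Fixpoint played t : t.-tuple {set 'I_m} :=
  match t with
  | 0 => [tuple]
  | t.+1 => [tuple of rcons (played t) (next_action (played t))]
  end.

End run.

Variables (r : 'rV[R]_K -> R) (nu : cmab R m K) (psi : strategy R m K).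
Let pi := psi (cmab_actions nu).

(* The t-th component of the sample point is the pair (U_t, X^(t+1)). *)
Definition round_law T : probability (T.-tuple (R * m.-tuple R)) R :=
  iid (rand_law pi \x cmab_law nu)%E T.

Definition regret (Sopt : {set 'I_m}) T (w : T.-tuple (R * m.-tuple R)) : R :=
  let u t := (nth (0, [tuple 0 | _ < m]) w t).1 in
  let x t := (nth (0, [tuple 0 | _ < m]) w t).2 in
  \sum_(S <- played pi u x T) (reward_of r nu Sopt - reward_of r nu S).

Definition expected_regret Sopt T : \bar R :=
  'E_(round_law T)[regret Sopt (T:=T)].

End interaction.

(* Main.v *)
Require Import Defs.
From HB Require Import structures.
From mathcomp Require Import all_boot all_order all_algebra perm.
From mathcomp Require Import all_classical all_reals all_analysis.
From mathcomp Require Import measurable_realfun zify ring lra.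
Import Order.TTheory GRing.Theory Num.Theory.
Import numFieldNormedType.Exports.
Set Implicit Arguments.
Unset Strict Implicit.
Unset Printing Implicit Defensive.
Local Open Scope ring_scope.

(* Fix I and let p be the sorted mean vector. All actions share |I| arms with
   deterministic rewards, and each has a private block of K_I arms. In the
   optimal block the arms are comonotone Bernoulli variables, so that their
   covariances are p_i (1 - p_j) for i <= j, and the score
   s = sum_i (grad_i r) (X_i - p_i) has variance gini^2. In the other blocks the
   law is tilted by the density 1 - eps s: the means move by
   - eps Cov(X_i, s), so the reward drops by about eps gini^2, while the
   chi-square distance to the optimal law is about eps^2 gini^2.
   Hiding the optimal block among the n = floor((m - K) / K_I) + 1 >= 3 blocks,
   the likelihood ratio M between "block a is optimal" and "no block is optimal"
   satisfies E[(M - 1)^2 / (1 + M)] <= C eps^2 gini^2 E[pulls of a]. Averaging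
   over a, the optimal block is played at most a fixed fraction of the time when
   eps is of order sqrt(n / T) / gini. *)

(** * Bandits with finitely many outcomes *)

Section finite_bandit.
Context {R : realFieldType} {n : nat} {Y : finType}.
Notation history := (seq ('I_n * Y)).
Variable alg : history -> 'I_n.
Implicit Types (W : 'I_n -> Y -> R) (f g : history -> R) (h : history).

(** The rule [alg] is deterministic: the randomization of a strategy is frozen before the reduction
    to this model, so that only the outcomes remain random. *)
Fixpoint hexp W T f h : R :=
  if T is T'.+1
  then \sum_y W (alg h) y * hexp W T' f (rcons h (alg h, y)) else f h.

Definition pulls (a : 'I_n) h : nat := count (fun c => c.1 == a) h.

(* The likelihood ratio, given [h], between the bandit where the outcomes of [a]
   are reweighted by [L] and the one where all actions have the same law. *)
Definition likelihood (L : Y -> R) (a : 'I_n) h : R :=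
  \prod_(c <- h | c.1 == a) L c.2.

Lemma pulls_rcons a h c : pulls a (rcons h c) = (pulls a h + (c.1 == a))%N.
Proof. by rewrite /pulls -cats1 count_cat /= addn0. Qed.

Lemma sum_pulls h : (\sum_a pulls a h = size h)%N.
Proof.
elim/last_ind: h => [|h c IH]; first by rewrite big1.
rewrite (eq_bigr _ (fun a _ => pulls_rcons a h c)) big_split /= IH size_rcons.
rewrite (bigD1 c.1) //= eqxx big1 ?addn0 ?addn1 // => a /negPf.
by rewrite eq_sym => ->.
Qed.

Lemma likelihood_rcons L a h c :
  likelihood L a (rcons h c) = likelihood L a h * (if c.1 == a then L c.2 else 1).
Proof.
rewrite /likelihood -cats1 big_cat big_cons big_nil /=.
by case: ifP => _; rewrite ?mulr1.
Qed.

Lemma likelihood_gt0 L a h : (forall y, 0 < L y) -> 0 < likelihood L a h.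
Proof. by move=> L0; apply: prodr_gt0. Qed.

Lemma eq_hexp W T f g h : (forall h', size h' = (size h + T)%N -> f h' = g h') ->
  hexp W T f h = hexp W T g h.
Proof.
elim: T h => [|T IH] h fg /=; first by apply: fg; rewrite addn0.
apply: eq_bigr => y _; congr (_ * _); apply: IH => h' sh'.
by apply: fg; rewrite sh' size_rcons addnS.
Qed.

Lemma hexpD W T f g h :
  hexp W T (fun h => f h + g h) h = hexp W T f h + hexp W T g h.
Proof.
elim: T h => [|T IH] h //=; rewrite -big_split /=.
by apply: eq_bigr => y _; rewrite IH mulrDr.
Qed.

Lemma hexpZ W T c f h : hexp W T (fun h => c * f h) h = c * hexp W T f h.
Proof.
elim: T h => [|T IH] h //=; rewrite big_distrr /=.
by apply: eq_bigr => y _; rewrite IH mulrCA.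
Qed.

Lemma hexp_sum (I : finType) W T (F : I -> history -> R) h :
  hexp W T (fun h => \sum_i F i h) h = \sum_i hexp W T (F i) h.
Proof.
elim: T h => [|T IH] h //=; rewrite exchange_big /=.
by apply: eq_bigr => y _; rewrite IH big_distrr.
Qed.

Lemma hexp_cst W T c h : (forall b, \sum_y W b y = 1) -> hexp W T (fun=> c) h = c.
Proof.
move=> W1; elim: T h => [|T IH] h //=.
by under eq_bigr do rewrite IH; rewrite -big_distrl /= W1 mul1r.
Qed.

Lemma le_hexp W T f g h : (forall b y, 0 <= W b y) ->
  (forall h', size h' = (size h + T)%N -> f h' <= g h') ->
  hexp W T f h <= hexp W T g h.
Proof.
move=> W0; elim: T h => [|T IH] h fg /=; first by apply: fg; rewrite addn0.
apply: ler_sum => y _; apply: ler_wpM2l => //; apply: IH => h' sh'.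
by apply: fg; rewrite sh' size_rcons addnS.
Qed.

Lemma hexp_supermartingale W T f h : (forall b y, 0 <= W b y) ->
  (forall h, \sum_y W (alg h) y * f (rcons h (alg h, y)) <= f h) ->
  hexp W T f h <= f h.
Proof.
move=> W0 fW; elim: T h => [|T IH] h //=; apply: le_trans (fW h).
by apply: ler_sum => y _; apply: ler_wpM2l.
Qed.

Variables (Q L : Y -> R) (kappa : R).
Hypotheses (Q0 : forall y, 0 <= Q y) (Q1 : \sum_y Q y = 1).
Hypotheses (QL1 : \sum_y Q y * L y = 1) (Lge : forall y, 8 / 9 <= L y).
Hypothesis kappaE : 2 / 3 * \sum_y Q y * (L y - 1) ^+ 2 <= kappa.

Let L0 y : 0 < L y. Proof. by have := Lge y; lra. Qed.

Definition tilted (a b : 'I_n) (y : Y) : R := if b == a then Q y * L y else Q y.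

(** Change of measure: the two laws differ only on the rounds that play [a], each of which
    contributes one factor [L]. The factor on the left accounts for the rounds already in [h]. *)
Lemma hexp_tilted a T f h :
  hexp (tilted a) T f h * likelihood L a h =
  hexp (fun=> Q) T (fun h => likelihood L a h * f h) h.
Proof.
elim: T h => [|T IH] h /=; first by rewrite mulrC.
rewrite big_distrl /=; apply: eq_bigr => y _; rewrite -IH likelihood_rcons /tilted /=.
by case: ifP => _; ring.
Qed.

(* An algebraic substitute for the Kullback-Leibler divergence: it controls the
   total variation, and its expectation grows additively along the rounds. *)
Definition discrepancy (M : R) : R := M - 3 + 4 / (1 + M).

Lemma discrepancyE M : 0 < M -> discrepancy M = (M - 1) ^+ 2 / (1 + M).
Proof. by move=> M0; rewrite /discrepancy; field; apply/lt0r_neq0; lra. Qed.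

(** Taylor expansion at [x = 1]. The slack has the sign of [(1 + M)^2 (1 + M x) - 6 M^2], and
    [x >= 8/9] reduces its nonnegativity to [4 (1 + M)^3 >= 27 M^2]. *)
Lemma discrepancy_step M x : 0 < M -> 8 / 9 <= x ->
  discrepancy (M * x) <=
  discrepancy M + (1 - 4 / (1 + M) ^+ 2) * M * (x - 1) + 2 / 3 * (x - 1) ^+ 2.
Proof.
move=> M0 hx; rewrite /discrepancy -subr_ge0.
have Mx : 0 < 1 + M * x by rewrite addr_gt0 // mulr_gt0 //; lra.
set D := (X in 0 <= X).
have -> : D = (x - 1) ^+ 2 / (3 * ((1 + M) ^+ 2 * (1 + M * x))) *
    (2 * (1 + M) ^+ 2 * (1 + M * x) - 12 * M ^+ 2).
  by rewrite /D; field; rewrite !lt0r_neq0 //; lra.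
apply: mulr_ge0.
  by rewrite divr_ge0 ?sqr_ge0 // mulr_ge0 // mulr_ge0 ?sqr_ge0 // ltW.
have hs : (1 + M) ^+ 2 * (8 / 9 * (1 + M)) <= (1 + M) ^+ 2 * (1 + M * x).
  apply: ler_wpM2l; first exact: sqr_ge0.
  have : M * (8 / 9) <= M * x by rewrite ler_pM2l.
  lra.
have : 0 <= (M - 2) ^+ 2 * (4 * M + 1) by rewrite mulr_ge0 ?sqr_ge0 //; lra.
have -> : (M - 2) ^+ 2 * (4 * M + 1) = 4 * ((1 + M) ^+ 2 * (1 + M)) - 27 * M ^+ 2.
  by ring.
lra.
Qed.

(** Once [kappa] is subtracted for each pull of [a], the discrepancy is a supermartingale under [Q]:
    the linear term of [discrepancy_step] averages to zero because [L] has mean 1, and the quadratic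
    one is at most [kappa]. *)
Lemma hexp_discrepancy a T :
  hexp (fun=> Q) T (fun h => discrepancy (likelihood L a h)) [::] <=
  kappa * hexp (fun=> Q) T (fun h => (pulls a h)%:R) [::].
Proof.
pose f h := discrepancy (likelihood L a h) + - kappa * (pulls a h)%:R.
suff : hexp (fun=> Q) T f [::] <= f [::].
  have d0 : discrepancy (likelihood L a [::]) = 0.
    by rewrite /likelihood big_nil /discrepancy; field.
  by rewrite /f hexpD hexpZ d0 /= mulr0 addr0 mulNr subr_le0.
apply: hexp_supermartingale => // h; rewrite /f.
under eq_bigr do rewrite likelihood_rcons pulls_rcons /=.
case: (alg h == a); last first.
  under eq_bigr do rewrite mulr1 addn0.
  by rewrite -big_distrl /= Q1 mul1r.
set M := likelihood L a h; have M0 : 0 < M by apply: likelihood_gt0.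
set N := pulls a h; rewrite /=.
apply: (@le_trans _ _ (\sum_y (Q y * (discrepancy M - kappa * (N + 1)%:R) +
    (1 - 4 / (1 + M) ^+ 2) * M * (Q y * L y - Q y) +
    2 / 3 * (Q y * (L y - 1) ^+ 2)))).
  apply: ler_sum => y _.
  have := ler_wpM2l (Q0 y) (discrepancy_step M0 (Lge y)).
  lra.
rewrite !big_split /= -big_distrl -!big_distrr /= big_split /= sumrN QL1 Q1.
move: kappaE; rewrite natrD; lra.
Qed.

(** With [M] the likelihood and [N] the pulls of [a], the tilted mean of [N] is the mean of
    [N M = N + N (M - 1)] under [Q]. The second term is controlled by the discrepancy, [1/8 + M/8]
    having mean [1/4]. Under [Q] the pulls of all actions add up to [T]. *)
Lemma sum_pulls_tilted T :
  \sum_a hexp (tilted a) T (fun h => (pulls a h)%:R) [::] <=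
  T%:R + T%:R * (2 * kappa * T%:R + n%:R / 4).
Proof.
have W0 : forall b y, 0 <= (fun=> Q : Y -> R) (b : 'I_n) y by [].
have E1 (a : 'I_n) : hexp (fun=> Q) T (likelihood L a) [::] = 1.
  transitivity (hexp (fun=> Q) T (fun h => likelihood L a h * 1) [::]).
    by apply: eq_hexp => h _; rewrite mulr1.
  rewrite -hexp_tilted /likelihood big_nil mulr1 hexp_cst // => b.
  by rewrite /tilted; case: (b == a).
have step (a : 'I_n) : hexp (tilted a) T (fun h => (pulls a h)%:R) [::] <=
    hexp (fun=> Q) T (fun h => (pulls a h)%:R) [::] * (1 + 2 * kappa * T%:R)
    + T%:R / 4.
  have := hexp_tilted a T (fun h => (pulls a h)%:R) [::].
  rewrite [X in _ * X]big_nil mulr1 => ->.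
  set E := hexp _ _ _ _; set N := hexp _ _ _ _.
  suff : E <= hexp (fun=> Q) T (fun h => (pulls a h)%:R +
      T%:R * (2 * discrepancy (likelihood L a h) +
              (8^-1 + 8^-1 * likelihood L a h))) [::].
    move=> /le_trans; apply; rewrite hexpD hexpZ 2!hexpD !hexpZ hexp_cst // E1.
    have := ler_wpM2l (ler0n R T) (hexp_discrepancy a T); rewrite -/N.
    lra.
  apply: le_hexp => // h; rewrite add0n => sh.
  have M0 := likelihood_gt0 a h L0; set M := likelihood L a h in M0 *.
  have Nle : (pulls a h)%:R <= T%:R :> R.
    by rewrite ler_nat -sh count_size.
  (* AM-GM: [|M - 1| <= 2 (M - 1)^2 / (1 + M) + (1 + M) / 8]. *)
  have key : M - 1 <= 2 * discrepancy M + (8^-1 + 8^-1 * M).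
    rewrite discrepancyE // -subr_ge0.
    set D := (X in 0 <= X).
    have -> : D = (4 * (M - 1) - (1 + M)) ^+ 2 / (8 * (1 + M)).
      by rewrite /D; field; apply/lt0r_neq0; lra.
    by rewrite divr_ge0 ?sqr_ge0 //; lra.
  (* Nonnegativity lets [T] replace the number of pulls in front of this error term. *)
  have k0 : 0 <= 2 * discrepancy M + (8^-1 + 8^-1 * M).
    rewrite discrepancyE //; have : 0 <= (M - 1) ^+ 2 / (1 + M).
      by rewrite divr_ge0 ?sqr_ge0 //; lra.
    lra.
  apply: (@le_trans _ _ ((pulls a h)%:R + (pulls a h)%:R *
    (2 * discrepancy M + (8^-1 + 8^-1 * M)))); last first.
    by rewrite lerD2l ler_wpM2r.
  have := ler_wpM2l (ler0n R (pulls a h)) key; lra.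
apply: le_trans (ler_sum _ (fun a _ => step a)) _.
rewrite big_split /= -big_distrl /= -hexp_sum sumr_const card_ord.
have -> : hexp (fun=> Q) T (fun h => \sum_a (pulls a h)%:R) [::] = T%:R.
  rewrite -[RHS](@hexp_cst (fun=> Q) T T%:R [::]) //.
  by apply: eq_hexp => h; rewrite add0n -natr_sum sum_pulls => ->.
rewrite -mulr_natr; lra.
Qed.

End finite_bandit.

(** * Finitely supported laws and product measures *)

Section finite_law.
Context d (T : measurableType d) (R : realType) (Om : finType) (o0 : Om).
Variables (w : Om -> R) (x : Om -> T).
Hypotheses (w0 : forall o, 0 <= w o) (w1 : \sum_o w o = 1).
Local Open Scope ereal_scope.

Let atom k := nth o0 (enum Om) k.

(** The atoms are numbered so that the measure structure is inherited from [msum]. *)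
Let law_msum : set T -> \bar R :=
  msum (fun k => mscale (NngNum (w0 (atom k))) \d_(x (atom k))) #|Om|.

HB.instance Definition _ := Measure.on law_msum.

Let reindex_atoms (F : Om -> \bar R) :
  \sum_(k < #|Om|) F (atom k) = \sum_o F o.
Proof.
by rewrite -[RHS]big_enum (big_nth o0) -cardE big_mkord.
Qed.

Let law_msumE A : law_msum A = \sum_o (w o)%:E * \d_(x o) A.
Proof. by rewrite -reindex_atoms. Qed.

Let law_msum_setT : law_msum setT = 1.
Proof.
rewrite law_msumE; under eq_bigr do rewrite diracT mule1.
by rewrite sumEFin w1.
Qed.

Definition finite_law : probability T R :=
  HB.pack law_msum (Measure_isProbability.Build _ _ _ law_msum law_msum_setT).

Lemma finite_lawE A : finite_law A = \sum_o (w o)%:E * \d_(x o) A.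
Proof. exact: law_msumE. Qed.

Lemma ge0_integral_finite_law (f : T -> \bar R) :
  measurable_fun setT f -> (forall t, 0 <= f t) ->
  \int[finite_law]_t f t = \sum_o (w o)%:E * f (x o).
Proof.
move=> mf f0; rewrite -reindex_atoms.
rewrite [LHS]ge0_integral_measure_sum //; apply: eq_bigr => k _.
by rewrite ge0_integral_mscale // integral_dirac // diracT mul1e.
Qed.

Lemma expectation_finite_law (f : T -> R) : measurable_fun setT f ->
  'E_finite_law[f] = (\sum_o w o * f (x o))%:E.
Proof.
move=> mf; rewrite unlock integralE.
rewrite !ge0_integral_finite_law //; first last.
  exact/measurable_funepos/measurable_EFinP.
  exact/measurable_funeneg/measurable_EFinP.
under eq_bigr do rewrite funeposE -EFin_max -EFinM.
under [X in _ - X]eq_bigr do rewrite funenegE -EFinN -EFin_max -EFinM.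
rewrite !sumEFin -EFinB -sumrB; congr EFin; apply: eq_bigr => o _.
rewrite -mulrBr; congr (_ * _)%R.
case: (leP 0%R (f (x o))) => h; rewrite /Num.max.
  by case: ltgtP; lra.
by case: ltgtP; lra.
Qed.

End finite_law.

(** * Integrals over independent rounds as iterated finite sums *)

Section iterated.
Context d d' (U : measurableType d) (T : measurableType d') (R : realType).
Context (E : Type) (Om : finType).
Variables (rho : probability U R) (law : E -> probability T R).
Variables (w : E -> Om -> R) (x : E -> Om -> T).
Hypothesis w0 : forall e o, 0 <= w e o.
Hypothesis lawE : forall e (f : T -> \bar R),
  measurable_fun setT f -> (forall t, (0 <= f t)%E) ->
  (\int[law e]_t f t = \sum_o (w e o)%:E * f (x e o))%E.

(* Keeping the first component [u] frozen reduces the statements on T rounds to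
   finite sums, whatever the law [rho]. *)
Fixpoint iterated_sum e n (u : nat -> U) : (n.-tuple (U * T) -> R) -> R :=
  if n is n'.+1 then fun F => \sum_o w e o *
    iterated_sum e (u \o S) (fun v : n'.-tuple _ => F [tuple of (u 0, x e o) :: v])
  else fun F => F [tuple].

Lemma iterated_sumZ e n u c (F : n.-tuple (U * T) -> R) :
  iterated_sum e u (fun v => c * F v) = c * iterated_sum e u F.
Proof.
elim: n u F => [|n IH] u F //=; rewrite big_distrr /=.
by apply: eq_bigr => o _; rewrite IH mulrCA.
Qed.

Lemma ge0_integral_iidS d1 (Z : measurableType d1) (P : probability Z R) n
    (F : n.+1.-tuple Z -> \bar R) :
  measurable_fun setT F -> (forall v, 0 <= F v)%E ->
  (\int[iid P n.+1]_v F v = \int[P]_z \int[iid P n]_v F [tuple of z :: v])%E.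
Proof.
move=> mF F0; rewrite /= ge0_integral_pushforward //=; last first.
  exact: measurable_cons.
rewrite fubini_tonelli1 //.
apply: measurableT_comp => //; exact: measurable_cons.
Qed.

(** Induction on the rounds, with the index type [I] generalized: the first outcome ranges over a
    finite type and is moved into the index, while the first randomization is integrated last,
    against a bound that holds for each of its values. *)
Lemma iid_lower_bound n (I : finType) (e : I -> E)
    (F : I -> n.-tuple (U * T) -> R) (B : R) :
  0 <= B -> (forall i, measurable_fun setT (F i)) -> (forall i v, 0 <= F i v) ->
  (forall u, B <= \sum_i iterated_sum (e i) u (F i)) ->
  (B%:E <= \sum_i \int[iid (rho \x law (e i))%E n]_v (F i v)%:E)%E.
Proof.
move=> B0; elim: n I e F => [|n IH] I e F mF F0 BF.
  apply: le_trans (_ : (\sum_i F i [tuple])%:E <= _)%E.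
    by rewrite lee_fin; exact: (BF (fun=> point)).
  rewrite -sumEFin; apply: lee_sum => i _ /=.
  rewrite integral_dirac ?diracT ?mul1e //.
  exact/measurable_EFinP.
pose G i (z : U * T) : \bar R :=
  (\int[iid (rho \x law (e i))%E n]_v (F i [tuple of z :: v])%:E)%E.
have mFc i : measurable_fun setT
    (fun zv : (U * T) * n.-tuple (U * T) => (F i [tuple of zv.1 :: zv.2])%:E).
  apply/measurable_EFinP; apply: measurableT_comp => //; exact: measurable_cons.
have mG i : measurable_fun setT (G i).
  apply: (@measurable_fun_fubini_tonelli_F _ _ _ _ _ (iid (rho \x law (e i))%E n)
    (fun zv => (F i [tuple of zv.1 :: zv.2])%:E)) => // zv.
  by rewrite lee_fin.
have G0 i z : (0 <= G i z)%E by apply: integral_ge0 => v _; rewrite lee_fin.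
have intG i : (\int[iid (rho \x law (e i))%E n.+1]_v (F i v)%:E =
    \int[rho]_u \sum_o (w (e i) o)%:E * G i (u, x (e i) o))%E.
  rewrite (@ge0_integral_iidS _ _ _ _ (EFin \o F i)); last 2 first.
    exact/measurable_EFinP.
    by move=> v; rewrite lee_fin.
  rewrite -/(G i) [LHS](@fubini_tonelli1 _ _ _ _ _ rho (law (e i)) (G i)) //.
  apply: eq_integral => u _; rewrite /fubini_F lawE //.
  exact: measurableT_comp.
have mGo i o : measurable_fun setT (fun u => (w (e i) o)%:E * G i (u, x (e i) o))%E.
  apply: measurable_funeM; exact: measurableT_comp.
under eq_bigr do rewrite intG.
rewrite -ge0_integral_sum //; last 2 first.
  by move=> i; apply: emeasurable_sum => o.
  by move=> i u _; apply: sume_ge0 => o _; rewrite mule_ge0 // lee_fin.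
have -> : (B%:E = \int[rho]_u B%:E)%E.
  rewrite integral_cst // -[LHS]mule1; congr (_ * _)%E.
  exact/esym/probability_setT.
apply: ge0_le_integral => //.
  by apply: emeasurable_sum => i; apply: emeasurable_sum => o.
move=> u0 _.
rewrite pair_big /=.
(* The first outcome joins the index, and its weight is absorbed by the function. *)
pose F' (io : I * Om) (v : n.-tuple (U * T)) :=
  w (e io.1) io.2 * F io.1 [tuple of (u0, x (e io.1) io.2) :: v].
have mF1 i z : measurable_fun setT (fun v : n.-tuple (U * T) => F i [tuple of z :: v]).
  apply: measurableT_comp => //; exact: measurable_cons.
apply: le_trans (IH (I * Om)%type (fun io => e io.1) F' _ _ _) _.
- by move=> io; apply: measurable_funM => //.
- by move=> io v; apply: mulr_ge0.
- move=> u; rewrite (_ : \sum_i _ = \sum_i iterated_sum (e i)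
    (fun k => if k is k'.+1 then u k' else u0) (F i)) //.
  by rewrite /= pair_big /=; apply: eq_bigr => io _; rewrite /F' iterated_sumZ.
apply: lee_sum => io _; rewrite /F'.
under eq_integral do rewrite EFinM.
rewrite ge0_integralZl //.
- exact/measurable_EFinP.
- by move=> v _; rewrite lee_fin.
- by rewrite lee_fin.
Qed.

End iterated.

(** * Policies and regret *)

Section policies.
Context {R : realType} {m K : nat} (A : action_set m K) (pi : policy R A).

Lemma choose_action_in t past h : @choose_action _ _ _ _ pi t past h \in (A : {set _}).
Proof. by case: pi => rho c H1 H2 H3 /=. Qed.

Lemma measurable_choose_action t past S :
  measurable (@choose_action _ _ _ _ pi t past @^-1` [set S])%classic.
Proof. by case: pi => rho c H1 H2 H3 /=. Qed.

Lemma played_in u x t S : S \in played pi u x t -> S \in (A : {set _}).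
Proof.
elim: t => [|t IH] //=; rewrite mem_rcons in_cons => /orP[/eqP ->|/IH //].
exact: choose_action_in.
Qed.

Local Notation Z := (R * m.-tuple R)%type.
Let z0 : Z := (0, [tuple 0 | _ < m]).

Lemma measurable_keep S : measurable_fun setT (@keep R m S).
Proof.
apply/measurable_fun_tnthP => i.
rewrite (_ : _ \o _ = fun x => if i \in S then tnth x i else 0).
  by case: (i \in S); [exact: measurable_tnth|exact: measurable_cst].
by apply/funext => x; rewrite /= tnth_mktuple.
Qed.

Lemma measurable_nth T t : measurable_fun setT (fun w : T.-tuple Z => nth z0 w t).
Proof.
have [tT|Tt] := ltnP t T.
  rewrite (_ : (fun _ => _) = (fun w : T.-tuple Z => tnth w (Ordinal tT))).
    exact: measurable_tnth.
  by apply/funext => w; rewrite (tnth_nth z0).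
rewrite (_ : (fun _ => _) = cst z0); first exact: measurable_cst.
by apply/funext => w; rewrite nth_default // size_tuple.
Qed.

Let u_of T (w : T.-tuple Z) t := (nth z0 w t).1.
Let x_of T (w : T.-tuple Z) t := (nth z0 w t).2.

(** Splitting off the last action of [past] leaves an event of the same kind and a condition on
    [choose_action] at a fixed past, which is the form in which policies are measurable. *)
Lemma measurable_played T t (past : t.-tuple _) :
  measurable [set w : T.-tuple Z | played pi (u_of w) (x_of w) t = past]%classic.
Proof.
elim: t past => [|t IH] past.
  rewrite (_ : [set w | _]%classic = setT)%classic //.
  by apply/seteqP; split => // w _ /=; rewrite [past]tuple0.
case/tupleP: past => S0 past0.
have [S [past ->]] : exists (S : {set 'I_m}) (past : t.-tuple {set 'I_m}),
    [tuple of S0 :: past0] = [tuple of rcons past S] :> t.+1.-tuple {set 'I_m}.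
  exists (last S0 past0).
  have sz : size (belast S0 past0) == t by rewrite size_belast size_tuple.
  by exists (Tuple sz); apply: val_inj => /=; rewrite -lastI.
pose hist (w : T.-tuple Z) := ([tuple keep (tnth past i) (x_of w i) | i < t],
  [tuple u_of w i | i < t.+1]).
rewrite (_ : [set w | _]%classic =
    ([set w : T.-tuple Z | played pi (u_of w) (x_of w) t = past] `&`
     (hist @^-1` (@choose_action _ _ _ _ pi t past @^-1` [set S])))%classic); last first.
  apply/seteqP; split => w /=.
    move=> /(congr1 val) /= /rcons_inj [/val_inj E1 E2].
    by split => //; rewrite -E1 in E2 *; rewrite -E2 /hist -E1.
  by case=> -> E; apply: val_inj => /=; congr rcons.
apply: measurableI; first exact: IH.
rewrite -[X in measurable X]setTI.
suff mh : measurable_fun setT hist.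
  by apply: mh => //; exact: measurable_choose_action.
apply/measurable_fun_pairP; split => /=; apply/measurable_fun_tnthP => i.
  rewrite (_ : _ \o _ = fun w : T.-tuple Z => keep (tnth past i) (x_of w i)).
    apply: measurableT_comp; first exact: measurable_keep.
    by apply: measurableT_comp => //; exact: measurable_nth.
  by apply/funext => w; rewrite /= tnth_mktuple.
rewrite (_ : _ \o _ = fun w : T.-tuple Z => u_of w i).
  by apply: measurableT_comp => //; exact: measurable_nth.
by apply/funext => w; rewrite /= tnth_mktuple.
Qed.

Lemma measurable_fun_played T (g : T.-tuple {set 'I_m} -> R) :
  measurable_fun setT (fun w : T.-tuple Z => g (played pi (u_of w) (x_of w) T)).
Proof.
move=> _ B mB; rewrite setTI.
rewrite (_ : _ @^-1` _ = \bigcup_(past in [set past | B (g past)])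
  [set w : T.-tuple Z | played pi (u_of w) (x_of w) T = past])%classic.
  apply: fin_bigcup_measurable; first exact: finite_finset.
  by move=> past _; exact: measurable_played.
apply/seteqP; split => w /=; first by move=> Bw; exists (played pi (u_of w) (x_of w) T).
by case=> past /= Bp ->.
Qed.

End policies.

Section regret.
Context {R : realType} {m K : nat} (r : 'rV[R]_K -> R) (nu : cmab R m K).

Lemma measurable_regret psi S T : measurable_fun setT (@regret R m K r nu psi S T).
Proof.
exact: (@measurable_fun_played _ _ _ _ (psi (cmab_actions nu)) T
  (fun past => \sum_(S' <- past) (reward_of r nu S - reward_of r nu S'))).
Qed.

Lemma regret_ge0 psi S T w : optimal r nu S -> 0 <= @regret R m K r nu psi S T w.
Proof.
move=> [_ opt]; rewrite /regret big_seq; apply: sumr_ge0 => S' S'in.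
by rewrite subr_ge0; apply: opt; exact: played_in S'in.
Qed.

(** The increasing enumeration of the arms and [e] differ by a permutation, which the symmetry of
    [r] on the cube absorbs. *)
Lemma reward_ofE (e : 'I_K -> 'I_m) : smooth_index_invariant r -> injective e ->
  cube (\row_i arm_mean nu (e i)) ->
  reward_of r nu [set e i | i : 'I_K]%SET = r (\row_i arm_mean nu (e i)).
Proof.
move=> [_ symr] inje cubee; set S := [set _ | _ : _]%SET.
have /tuple_permP[s Es] : perm_eq (enum S) [tuple e i | i < K].
  apply: uniq_perm; first exact: enum_uniq.
    by rewrite map_inj_uniq // enum_uniq.
  move=> j; rewrite mem_enum; apply/imsetP/mapP => [[i _ ->]|[i _ ->]].
    by exists i => //; rewrite mem_enum.
  by exists i.
rewrite -(symr _ s cubee); congr r; apply/rowP => i; rewrite !mxE Es.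
rewrite (nth_map (e i)) ?size_tuple //.
by rewrite -[X in nth _ _ X]/(nat_of_ord i) -tnth_nth !tnth_mktuple.
Qed.

End regret.

(** * Problems with one distinguished block *)

Section environment.
Context {R : realType} {m K n : nat} {Y : finType}.
(* [e b i] is the i-th arm of block [b]; the positions [i >= k] are the arms
   shared by all blocks. *)
Variables (k : nat) (e : 'I_n -> 'I_K -> 'I_m) (b0 : 'I_n) (y0 : Y).
Hypothesis e_inj : forall b b' i i', e b i = e b' i' -> i = i' /\ (b = b' \/ (k <= i)%N).
Hypothesis e_common : forall b b' (i : 'I_K), (k <= i)%N -> e b i = e b' i.
Variable X : Y -> 'rV[R]_K.
Hypothesis X_cube : forall y, cube (X y).
Hypothesis X_cst : forall y y' (i : 'I_K), (k <= i)%N -> X y ord0 i = X y' ord0 i.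
Variables P Q : Y -> R.
Hypotheses (P0 : forall y, 0 <= P y) (P1 : \sum_y P y = 1).
Hypotheses (Q0 : forall y, 0 <= Q y) (Q1 : \sum_y Q y = 1).

Definition block (b : 'I_n) : {set 'I_m} := [set e b i | i : 'I_K]%SET.

Definition common : {set 'I_m} := [set e b0 i | i : 'I_K & (k <= i)%N]%SET.

Lemma e_injective b : injective (e b).
Proof. by move=> i i' /e_inj[]. Qed.

Lemma block_meet b b' : b != b' -> block b :&: block b' = common.
Proof.
move=> bb'; apply/setP => j; rewrite inE; apply/andP/imsetP.
  case=> /imsetP[i _ ->] /imsetP[i' _ Ei].
  have [_ [Eb|ki]] := e_inj Ei; first by rewrite Eb eqxx in bb'.
  by exists i; rewrite ?inE //; exact: e_common.
case=> i; rewrite inE => ki ->.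
rewrite {1}(e_common b0 b ki) (e_common b0 b' ki).
by rewrite !imset_f.
Qed.

Definition blocks : {set {set 'I_m}} := [set block b | b : 'I_n]%SET.

Lemma blocks_neq0 : blocks != finset.set0.
Proof. by apply/set0Pn; exists (block b0); rewrite imset_f. Qed.

Lemma card_blocks : [forall S in blocks, #|S| == K].
Proof.
apply/forall_inP => _ /imsetP[b _ ->].
by rewrite card_imset ?card_ord //; exact: e_injective.
Qed.

Definition block_actions : action_set m K := ActionSet blocks_neq0 card_blocks.

(** Arms outside all blocks are constantly 0. A shared arm may be found through any block; the
    choice is harmless because [X] is constant at the shared positions. *)
Definition outcome (yy : 'I_n -> Y) : m.-tuple R :=
  [tuple if [pick bi | e bi.1 bi.2 == j] is Some bi
         then X (yy bi.1) ord0 bi.2 else 0 | j < m].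

Lemma outcomeE yy b i : tnth (outcome yy) (e b i) = X (yy b) ord0 i.
Proof.
rewrite tnth_mktuple; case: pickP => [[b' i'] /= /eqP /e_inj[-> [->//|]]|].
  by move=> ki; exact: X_cst.
by move=> /(_ (b, i)); rewrite eqxx.
Qed.

Lemma outcome_unit yy j : 0 <= tnth (outcome yy) j <= 1.
Proof.
rewrite tnth_mktuple; case: pickP => [bi _|_]; first exact: X_cube.
by rewrite lexx ler01.
Qed.

Definition observation b y : m.-tuple R := keep (block b) (outcome (fun=> y)).

(** Playing a block reveals nothing about the outcomes of the others; this is what reduces the
    semi-bandit to a bandit with [n] actions. *)
Lemma keep_outcome yy b : keep (block b) (outcome yy) = observation b (yy b).
Proof.
apply: eq_from_tnth => j; rewrite [LHS]tnth_mktuple [RHS]tnth_mktuple.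
by case: ifP => // /imsetP[i _ ->]; rewrite !outcomeE.
Qed.

Definition pick_outcome (a b : 'I_n) (o : Y * Y) := if b == a then o.1 else o.2.

(* The outcomes of the blocks other than [a] are fully dependent: a single block
   is observed in each round, so that only the marginals matter. *)
Definition sample (a : 'I_n) (o : Y * Y) : m.-tuple R :=
  outcome (pick_outcome a ^~ o).

Definition pair_weight (o : Y * Y) : R := P o.1 * Q o.2.

Lemma pair_weight_ge0 o : 0 <= pair_weight o.
Proof. exact: mulr_ge0. Qed.

Definition block_weight (a b : 'I_n) y : R := if b == a then P y else Q y.

Lemma pair_weight_marginal a b (g : Y -> R) :
  \sum_o pair_weight o * g (pick_outcome a b o) = \sum_y block_weight a b y * g y.
Proof.
rewrite /pair_weight /pick_outcome /block_weight.
rewrite -(pair_bigA _ (fun y z => P y * Q z * g (if b == a then y else z))) /=.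
case: (b == a).
  by apply: eq_bigr => y _; rewrite -big_distrl -big_distrr /= Q1 mulr1.
rewrite exchange_big; apply: eq_bigr => y _.
by rewrite -[RHS]mul1r -P1 big_distrl; apply: eq_bigr => z _; rewrite /= mulrA.
Qed.

Lemma pair_weight_sum1 : \sum_o pair_weight o = 1.
Proof.
have := pair_weight_marginal b0 b0 (fun=> 1).
under eq_bigr do rewrite mulr1.
under [X in _ = X]eq_bigr do rewrite mulr1 /block_weight eqxx.
by rewrite P1.
Qed.

Definition env_law a : probability (m.-tuple R) R :=
  finite_law (y0, y0) (sample a) pair_weight_ge0 pair_weight_sum1.

Lemma env_law_unit a : env_law a [set x | forall i, 0 <= tnth x i <= 1]%classic = 1%E.
Proof.
rewrite finite_lawE.
transitivity (\sum_o (pair_weight o)%:E)%E; last first.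
  by rewrite sumEFin pair_weight_sum1.
apply: eq_bigr => o _; rewrite diracE mem_set ?mule1 //= => i.
exact: outcome_unit.
Qed.

Definition env a : cmab R m K := Cmab block_actions (env_law_unit a).

Definition block_means (a b : 'I_n) : 'rV[R]_K :=
  \sum_y block_weight a b y *: X y.

Lemma arm_mean_env a b i : arm_mean (env a) (e b i) = block_means a b ord0 i.
Proof.
rewrite /arm_mean expectation_finite_law; last exact: measurable_tnth.
rewrite /= (eq_bigr (fun o => pair_weight o * X (pick_outcome a b o) ord0 i)).
  rewrite (pair_weight_marginal a b (fun y => X y ord0 i)) summxE.
  by apply: eq_bigr => y _; rewrite mxE.
by move=> o _; rewrite outcomeE.
Qed.

Lemma block_weight_ge0 a b y : 0 <= block_weight a b y.
Proof. by rewrite /block_weight; case: ifP. Qed.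

Lemma block_weight_sum1 a b : \sum_y block_weight a b y = 1.
Proof. by rewrite /block_weight; case: (b == a). Qed.

Lemma block_means_cube a b : cube (block_means a b).
Proof.
move=> i; rewrite summxE; apply/andP; split.
  apply: sumr_ge0 => y _; rewrite mxE mulr_ge0 ?block_weight_ge0 //.
  by have /andP[] := X_cube y i.
rewrite -(block_weight_sum1 a b); apply: ler_sum => y _; rewrite mxE.
rewrite ler_piMr ?block_weight_ge0 //.
by have /andP[] := X_cube y i.
Qed.

(** The shared arms are deterministic, so every event about them has probability 0 or 1 and is
    independent of all others. *)
Lemma env_J_disjoint a : J_disjoint (env a) common.
Proof.
split=> [A B mA mB | S1 S2 /imsetP[b _ ->] /imsetP[b' _ ->] bb' |].
- set c := keep common (outcome (fun=> y0)).
  have keepc o : keep common (sample a o) = c.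
    apply: eq_from_tnth => j; rewrite [LHS]tnth_mktuple [RHS]tnth_mktuple.
    case: ifP => // /imsetP[i]; rewrite inE => ki ->.
    by rewrite !outcomeE; exact: X_cst.
  rewrite -[cmab_law _]/(env_law a) !finite_lawE.
  have [cA|cA] := pselect (A c).
    rewrite [X in (X * _)%E](_ : _ = 1%E) ?mul1e; last first.
      transitivity (\sum_o (pair_weight o)%:E)%E; last first.
        by rewrite sumEFin pair_weight_sum1.
      by apply: eq_bigr => o _; rewrite diracE mem_set ?mule1 //= keepc.
    apply: eq_bigr => o _; congr (_ * _)%E;
      rewrite !diracE; congr ((nat_of_bool _)%:R%:E).
    by apply/idP/idP; rewrite !inE /= keepc; [case|].
  rewrite [X in (X * _)%E]big1 ?mul0e; last first.
    by move=> o _; rewrite diracE memNset ?mule0 //= keepc.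
  by rewrite big1 // => o _; rewrite diracE memNset ?mule0 //= keepc => -[].
- apply: block_meet; apply: contraNneq bb' => -> //.
- by apply: leq_trans (leq_imset_card _ _) _; rewrite -[X in (_ <= X)%N]card_ord max_card.
Qed.

(** * Reduction of the block problems to finite bandits *)

Section interaction.
Variables (r : 'rV[R]_K -> R) (hr : smooth_index_invariant r) (Delta : R).
Hypothesis Delta0 : 0 <= Delta.
Hypothesis DeltaE : forall a b, b != a ->
  r (block_means a a) - r (block_means a b) = Delta.
Variable psi : strategy R m K.
Let pi := psi block_actions.

Lemma reward_block a b : reward_of r (env a) (block b) = r (block_means a b).
Proof.
have E : \row_i arm_mean (env a) (e b i) = block_means a b.
  by apply/rowP => i; rewrite mxE arm_mean_env.
by rewrite reward_ofE ?E //; [exact: e_injective|exact: block_means_cube].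
Qed.

Lemma optimal_block a : optimal r (env a) (block a).
Proof.
split; first by rewrite imset_f.
move=> _ /imsetP[b _ ->]; rewrite !reward_block.
have [->//|ba] := eqVneq b a.
by rewrite -subr_ge0 DeltaE.
Qed.

Let z0 : R * m.-tuple R := (0, [tuple 0 | _ < m]).
Let d0 : 'I_n * Y := (b0, y0).

Section fixed_randomization.
Variable u : nat -> R.

Definition block_of (S : {set 'I_m}) : 'I_n :=
  odflt b0 [pick b | block b == S].

Lemma block_ofK S : S \in blocks -> block (block_of S) = S.
Proof.
case/imsetP => b _ ->; rewrite /block_of.
by case: pickP => [b' /eqP //|/(_ b)]; rewrite eqxx.
Qed.

(** The length is a separate argument so that [size h] can be rewritten without touching the
    dependent tuple types. *)
Definition next_block_at t (h : seq ('I_n * Y)) : 'I_n :=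
  block_of (choose_action pi [tuple block (nth d0 h i).1 | i < t]
    ([tuple observation (nth d0 h i).1 (nth d0 h i).2 | i < t],
     [tuple u i | i < t.+1])).

Definition next_block h := next_block_at (size h) h.

Definition extend a (h : seq ('I_n * Y)) (o : Y * Y) :=
  rcons h (next_block h, pick_outcome a (next_block h) o).

Definition history a := foldl (extend a) [::].

Lemma history_rcons a s o : history a (rcons s o) = extend a (history a s) o.
Proof. by rewrite /history foldl_rcons. Qed.

Lemma size_history a s : size (history a s) = size s.
Proof.
by elim/last_ind: s => // s o IH; rewrite history_rcons !size_rcons IH.
Qed.

Lemma nth_history a s i : (i < size s)%N ->
  (nth d0 (history a s) i).2 =
  pick_outcome a (nth d0 (history a s) i).1 (nth (y0, y0) s i).
Proof.
elim/last_ind: s => // s o IH; rewrite size_rcons ltnS history_rcons.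
rewrite /extend !nth_rcons size_history leq_eqVlt => /orP[/eqP ->|si].
  by rewrite ltnn eqxx.
by rewrite si IH.
Qed.

(** By [keep_outcome], the observations made by the policy are those that [next_block] rebuilds from
    the history, so both runs choose the same action at each round. *)
Lemma played_history a s (u' : nat -> R) (x' : nat -> m.-tuple R) t :
  (t <= size s)%N -> (forall i, (i < size s)%N -> u' i = u i) ->
  (forall i, (i < size s)%N -> x' i = sample a (nth (y0, y0) s i)) ->
  tval (played pi u' x' t) = [seq block c.1 | c <- history a (take t s)].
Proof.
move=> ts u'E x'E; elim: t ts => [|t IH] ts; first by rewrite take0.
rewrite /= (take_nth (y0, y0)) // history_rcons /extend map_rcons /=.
have {IH} := IH (ltnW ts); set h := history a (take t s) => Eh.
have sh : size h = t by rewrite size_history size_takel // ltnW.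
rewrite Eh; congr rcons.
rewrite /next_block sh block_ofK ?choose_action_in // /next_action.
have -> : played pi u' x' t = [tuple block (nth d0 h i).1 | i < t].
  apply: eq_from_tnth => i; rewrite tnth_mktuple (tnth_nth (block b0)) Eh.
  by rewrite (nth_map d0) // sh.
congr (choose_action pi _ (_, _)).
  apply: eq_from_tnth => i; rewrite !tnth_mktuple x'E; last first.
    exact: ltn_trans (ltn_ord i) ts.
  rewrite keep_outcome nth_history ?nth_take ?size_takel ?(ltnW ts) //.
by apply: eq_from_tnth => i; rewrite !tnth_mktuple u'E // (leq_trans (ltn_ord i)).
Qed.

End fixed_randomization.

(** The list [s] of outcomes already drawn is generalized for the induction, and [u] is shifted
    accordingly. The next block depends only on the past, so the sum over a pair of outcomes
    collapses to the marginal of that block. *)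
Lemma iterated_sum_hexp a u n' s (G : seq (R * m.-tuple R) -> R) f :
  (forall s', size s' = (size s + n')%N ->
    G [seq (u i, sample a (nth (y0, y0) s' i)) | i <- iota 0 (size s')] =
    f (history u a s')) ->
  iterated_sum (fun=> pair_weight) sample a (fun i => u (size s + i)%N)
    (fun v : n'.-tuple _ => G
      ([seq (u i, sample a (nth (y0, y0) s i)) | i <- iota 0 (size s)] ++ v)) =
  hexp (next_block u) (block_weight a) n' f (history u a s).
Proof.
elim: n' s => [|n' IH] s Gf /=.
  by rewrite cats0 Gf // addn0.
rewrite -[RHS](pair_weight_marginal a _ (fun y => hexp _ _ n' f (rcons _ (_, y)))).
apply: eq_bigr => o _; congr (_ * _).
rewrite -[rcons _ _]/(extend u a (history u a s) o) -history_rcons -IH; last first.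
  by move=> s' ss'; apply: Gf; rewrite ss' size_rcons addnS.
rewrite size_rcons; congr (iterated_sum _ _ _ _ _).
  by apply/funext => i /=; rewrite addnS.
apply/funext => v; congr G.
rewrite -addn1 iotaD map_cat /= add0n -catA /= addn0.
rewrite nth_rcons ltnn eqxx; congr (_ ++ _).
apply/eq_in_map => i; rewrite mem_iota /= add0n => si.
by rewrite nth_rcons si.
Qed.

Lemma sum_gaps a (h : seq ('I_n * Y)) :
  \sum_(c <- h) (reward_of r (env a) (block a) - reward_of r (env a) (block c.1)) =
  Delta * ((size h)%:R - (pulls a h)%:R).
Proof.
elim: h => [|c h IH]; first by rewrite big_nil subrr mulr0.
rewrite big_cons IH /= !reward_block.
case: eqVneq => [->|ca]; first by rewrite subrr add0r -addn1 add1n !natrD; ring.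
by rewrite DeltaE // add0n -addn1 natrD; ring.
Qed.

Lemma iterated_sum_regret a u T :
  iterated_sum (fun=> pair_weight) sample a u
    (@regret R m K r (env a) psi (block a) T) =
  hexp (next_block u) (block_weight a) T
    (fun h => Delta * (T%:R - (pulls a h)%:R)) [::].
Proof.
pose G (z : seq (R * m.-tuple R)) :=
  \sum_(S <- played pi (fun t => (nth z0 z t).1) (fun t => (nth z0 z t).2) T)
    (reward_of r (env a) (block a) - reward_of r (env a) S).
apply: (@iterated_sum_hexp a u T [::] G) => s; rewrite add0n => sT.
have nthz i : (i < size s)%N ->
    nth z0 [seq (u j, sample a (nth (y0, y0) s j)) | j <- iota 0 (size s)] i =
    (u i, sample a (nth (y0, y0) s i)).
  by move=> si; rewrite (nth_map 0) ?size_iota // nth_iota.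
rewrite /G (@played_history u a s); last first.
- by move=> i si; rewrite nthz.
- by move=> i si; rewrite nthz.
- by rewrite sT.
by rewrite -sT take_size big_map sum_gaps size_history.
Qed.

Variables (L : Y -> R) (kappa : R).
Hypotheses (PE : forall y, P y = Q y * L y) (Lge : forall y, 8 / 9 <= L y).
Hypothesis kappaE : 2 / 3 * \sum_y Q y * (L y - 1) ^+ 2 <= kappa.

(** The law [Q] of the ordinary blocks is the reference, and [P = Q L] makes the optimal block the
    tilted action. Each round off [a] costs [Delta], so the bound on the pulls summed over [a]
    bounds the average regret from below. *)
Lemma env_regret T :
  let B := Delta * T%:R * (1 - n%:R^-1 - 2 * kappa * T%:R / n%:R - 4^-1) in
  0 <= B -> exists a, (B%:E <= expected_regret r (env a) psi (block a) T)%E.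
Proof.
move=> B B0.
have n0 : 0 < n%:R :> R by rewrite ltr0n; case: (n) b0 => // -[].
have lb : ((B * n%:R)%:E <= \sum_(a < n) expected_regret r (env a) psi (block a) T)%E.
  rewrite /expected_regret; under eq_bigr do rewrite unlock.
  apply: (@iid_lower_bound _ _ _ _ R 'I_n (Y * Y)%type (rand_law pi) env_law
    (fun=> pair_weight) sample _ _ T 'I_n id).
  - by move=> _; exact: pair_weight_ge0.
  - by move=> a f mf f0; exact: ge0_integral_finite_law.
  - by rewrite mulr_ge0 // ltW.
  - by move=> a; exact: measurable_regret.
  - by move=> a w; apply: regret_ge0; exact: optimal_block.
  move=> u; under eq_bigr do rewrite iterated_sum_regret.
  have E a : hexp (next_block u) (block_weight a) T
      (fun h => Delta * (T%:R - (pulls a h)%:R)) [::] =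
      Delta * T%:R - Delta * hexp (next_block u) (tilted Q L a) T
        (fun h => (pulls a h)%:R) [::].
    rewrite -mulrBr hexpZ; congr (_ * _).
    have -> : block_weight a = tilted Q L a.
      by apply/funext => b; apply/funext => y; rewrite /block_weight /tilted PE.
    transitivity (hexp (next_block u) (tilted Q L a) T
        (fun h => T%:R + -1 * (pulls a h)%:R) [::]).
      by apply: eq_hexp => h _; rewrite mulN1r.
    rewrite hexpD hexpZ hexp_cst ?mulN1r // => b.
    rewrite /tilted; case: (b == a) => //.
    by under eq_bigr do rewrite -PE.
  under eq_bigr do rewrite E.
  rewrite sumrB sumr_const card_ord -big_distrr /=.
  have QL1 : \sum_y Q y * L y = 1 by under eq_bigr do rewrite -PE.
  have := ler_wpM2l Delta0 (sum_pulls_tilted (next_block u) Q0 Q1 QL1 Lge kappaE T).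
  have -> : B * n%:R = Delta * T%:R * (n%:R - 1 - 2 * kappa * T%:R - n%:R / 4).
    by rewrite /B; field; rewrite lt0r_neq0.
  rewrite -mulr_natr; lra.
(* Pigeonhole: if every regret were below [B], all of them would be finite and their sum would be
   below [n B]. *)
have [//|/forallNP noa] := pselect (exists a,
  (B%:E <= expected_regret r (env a) psi (block a) T)%E).
have lt_a a : (expected_regret r (env a) psi (block a) T < B%:E)%E.
  by rewrite ltNge; apply/negP; exact: noa.
have ge0_a a : (0 <= expected_regret r (env a) psi (block a) T)%E.
  by apply: expectation_ge0 => w; apply: regret_ge0; exact: optimal_block.
have fin_a a : expected_regret r (env a) psi (block a) T \is a fin_num.
  by rewrite ge0_fin_numE // (lt_trans (lt_a a)) // ltry.
exfalso; move: lb; apply/negP; rewrite -ltNge.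
under eq_bigr do rewrite -(fineK (fin_a _)).
rewrite sumEFin lte_fin -[n in B * n%:R]card_ord mulr_natr -sumr_const.
apply: ltr_sum => [|a _].
  by apply/hasP; exists b0; rewrite ?mem_index_enum.
by rewrite -lte_fin fineK.
Qed.

End interaction.
End environment.

(** * Comonotone arms *)

Section comonotone.
Context {R : realType} {K : nat}.
Variables (k : nat) (s : seq R) (g : 'I_K -> R).
Hypothesis s_unit : forall i, (i < K)%N -> 0 <= s`_i <= 1.
Hypothesis s_sorted : forall i j, (i <= j < k)%N -> s`_i <= s`_j.
Hypothesis kK : (k <= K)%N.

(** This is the mass of [y < t]. The final value 1 gives the remaining mass to [y = k], where the
    [k] comonotone arms all vanish. *)
Let cdf (t : nat) : R :=
  if t is t'.+1 then if (t' < k)%N then s`_t' else 1 else 0.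

(* The law of [y] such that the k arms [y <= i] are comonotone Bernoulli
   variables with means [s_i]: they are [1] for [U <= s_i], U uniform. *)
Definition como_weight (y : 'I_k.+1) : R := cdf y.+1 - cdf y.

Definition como_arms (y : 'I_k.+1) : 'rV[R]_K :=
  \row_(i < K) if (i < k)%N then (y <= i)%N%:R else s`_i.

Definition como_score (y : 'I_k.+1) : R :=
  \sum_i g i * (como_arms y ord0 i - s`_i).

Lemma como_weight_ge0 y : 0 <= como_weight y.
Proof.
rewrite /como_weight /cdf; case: y => -[|y] yk /=.
  rewrite subr0; case: ifP => // k0.
  by have /andP[] := s_unit (leq_trans k0 kK).
rewrite ltnS in yk; rewrite yk subr_ge0; case: ifP => [yk'|_].
  by apply: s_sorted; rewrite leqnSn.
by have /andP[] := s_unit (leq_trans yk kK).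
Qed.

Lemma sum_como_weight_lt t : (t <= k.+1)%N ->
  \sum_(y < k.+1 | (y < t)%N) como_weight y = cdf t.
Proof.
move=> tk; rewrite -(big_ord_widen _ (fun y => cdf y.+1 - cdf y) tk).
by rewrite -(big_mkord xpredT (fun y => cdf y.+1 - cdf y)) telescope_sumr // subr0.
Qed.

Lemma sum_como_weight : \sum_y como_weight y = 1.
Proof.
rewrite -[LHS](@eq_bigl _ _ _ _ _ (fun y : 'I_k.+1 => (y < k.+1)%N)).
  by rewrite sum_como_weight_lt //= ltnn.
by move=> y; rewrite ltn_ord.
Qed.

Lemma sum_como_weight_le (i : nat) : (i < k)%N ->
  \sum_y como_weight y * (y <= i)%N%:R = s`_i.
Proof.
move=> ik; transitivity (\sum_(y < k.+1 | (y < i.+1)%N) como_weight y).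
  rewrite [RHS]big_mkcond; apply: eq_bigr => y _; rewrite ltnS.
  by case: (y <= i)%N; rewrite ?mulr1 ?mulr0.
by rewrite sum_como_weight_lt ?(leq_trans ik) //= ik.
Qed.

Lemma como_mean (i : 'I_K) : \sum_y como_weight y * como_arms y ord0 i = s`_i.
Proof.
under eq_bigr do rewrite mxE.
have [ik|ki] := ltnP i k; first exact: sum_como_weight_le.
by rewrite -big_distrl /= sum_como_weight mul1r.
Qed.

Lemma como_arms_cube y : cube (como_arms y).
Proof.
move=> i; rewrite mxE; case: ifP => _; last exact: s_unit.
by case: (y <= i)%N; rewrite ?lexx ler01.
Qed.

Lemma como_score_mean : \sum_y como_weight y * como_score y = 0.
Proof.
under eq_bigr do rewrite big_distrr /=.
rewrite exchange_big /= big1 // => i _.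
under eq_bigr do rewrite mulrCA mulrBr.
by rewrite -big_distrr sumrB /= como_mean -big_distrl /= sum_como_weight mul1r subrr mulr0.
Qed.

Definition como_cov (i j : 'I_K) : R := \sum_y como_weight y *
  ((como_arms y ord0 i - s`_i) * (como_arms y ord0 j - s`_j)).

Lemma como_covC i j : como_cov i j = como_cov j i.
Proof. by apply: eq_bigr => y _; congr (_ * _); rewrite mulrC. Qed.

Lemma como_cov_out (i j : 'I_K) : (k <= i)%N -> como_cov i j = 0.
Proof.
move=> ki; apply: big1 => y _; rewrite mxE ltnNge ki /=.
by rewrite subrr mul0r mulr0.
Qed.

(** When arm [i] equals 1, so does arm [j]; the product of the two thus has mean [s_i]. *)
Lemma como_covE (i j : 'I_K) : (i <= j < k)%N -> como_cov i j = s`_i * (1 - s`_j).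
Proof.
case/andP=> ij jk; have ik := leq_ltn_trans ij jk.
transitivity (\sum_y (como_weight y * (y <= i)%N%:R * (1 - s`_j) -
    s`_i * (como_weight y * (y <= j)%N%:R - s`_j * como_weight y))).
  apply: eq_bigr => y _; rewrite !mxE ik jk.
  have [yi|iy] := leqP y i; first by rewrite (leq_trans yi ij) /=; ring.
  by rewrite /=; ring.
rewrite sumrB -big_distrl -big_distrr sumrB -big_distrr /=.
by rewrite !sum_como_weight_le // sum_como_weight; ring.
Qed.

Lemma sum_sym (F : 'I_K -> 'I_K -> R) : (forall i j, F i j = F j i) ->
  \sum_i \sum_j F i j = \sum_i F i i + 2 * \sum_(i < K) \sum_(j < K | (i < j)%N) F i j.
Proof.
move=> symF.
transitivity (\sum_(i < K) (F i i + (\sum_(j < K | (i < j)%N) F i j +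
    \sum_(j < K | (j < i)%N) F i j))).
  apply: eq_bigr => i _; rewrite (bigD1 i) //= (bigID (fun j : 'I_K => (i < j)%N)) /=.
  congr (_ + (_ + _)); apply: eq_bigl => j; rewrite -(inj_eq val_inj) /=; by case: ltngtP.
rewrite !big_split /=; congr (_ + _); rewrite mulr_natl mulr2n; congr (_ + _).
rewrite (exchange_big_dep xpredT) //=.
by apply: eq_bigr => i _; apply: eq_bigr => j _; exact: symF.
Qed.

(** The variance is the quadratic form of the covariances at [g]. The shared positions have
    covariance 0, and folding by symmetry onto [i < j] yields the shape of [gini_sq]. *)
Lemma como_varE :
  \sum_y como_weight y * como_score y ^+ 2 =
  \sum_(i < K | (i < k)%N) s`_i * (1 - s`_i) * g i ^+ 2 +
  2 * \sum_(i < K | (i < k)%N) \sum_(j < K | (i < j < k)%N)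
     s`_i * (1 - s`_j) * g i * g j.
Proof.
transitivity (\sum_i \sum_j g i * g j * como_cov i j).
  under [RHS]eq_bigr do under eq_bigr do rewrite big_distrr /=.
  under [RHS]eq_bigr do rewrite exchange_big /=.
  rewrite [RHS]exchange_big /=; apply: eq_bigr => y _.
  rewrite expr2 /como_score big_distrl big_distrr /=; apply: eq_bigr => i _.
  by rewrite !big_distrr /=; apply: eq_bigr => j _; ring.
rewrite sum_sym => [|i j]; last by rewrite como_covC (mulrC (g i)).
congr (_ + 2 * _).
  rewrite [RHS]big_mkcond; apply: eq_bigr => i _.
  have [ik|ki] := ltnP; last by rewrite como_cov_out // mulr0.
  by rewrite como_covE ?leqnn //; ring.
rewrite [RHS]big_mkcond; apply: eq_bigr => i _.
have [ik|ki] := ltnP; last by rewrite big1 // => j _; rewrite como_cov_out // mulr0.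
rewrite big_mkcond [RHS]big_mkcond; apply: eq_bigr => j _.
have [ij|//] := ltnP; have [jk|kj] := ltnP j k; last first.
  by rewrite como_covC como_cov_out // mulr0.
by rewrite como_covE ?(ltnW ij) //=; ring.
Qed.

(* The derivative at [eps = 0] of the mean of the arms under the tilt
   [1 - eps * como_score], which maximises the first-order reward loss for a
   given chi-square distance. *)
Definition como_drift : 'rV[R]_K :=
  - \sum_y (como_weight y * como_score y) *: como_arms y.

(** As the score has mean zero, the drift is minus the covariance of the arms with the score;
    pairing it with [g] rebuilds the score. *)
Lemma sum_grad_drift :
  \sum_i como_drift ord0 i * g i = - \sum_y como_weight y * como_score y ^+ 2.
Proof.
have E i : como_drift ord0 i = - \sum_y como_weight y * como_score y *
    (como_arms y ord0 i - s`_i).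
  under [in RHS]eq_bigr do rewrite mulrBr.
  rewrite sumrB -big_distrl /= como_score_mean mul0r subr0.
  by rewrite mxE summxE; congr (- _); apply: eq_bigr => y _; rewrite mxE.
under eq_bigr do rewrite E mulNr big_distrl /=.
rewrite sumrN exchange_big /=; congr (- _); apply: eq_bigr => y _.
have -> : como_score y ^+ 2 =
  como_score y * \sum_i g i * (como_arms y ord0 i - s`_i) by rewrite expr2.
by rewrite mulrA [RHS]big_distrr /=; apply: eq_bigr => i _; ring.
Qed.

Lemma tilted_mean eps :
  \sum_y (como_weight y * (1 - eps * como_score y)) *: como_arms y =
  \row_i s`_i + eps *: como_drift.
Proof.
apply/rowP => i; rewrite summxE !mxE summxE -(como_mean i) mulrN big_distrr /= -sumrB.
by apply: eq_bigr => y _; rewrite !mxE; case: ifP => _; ring.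
Qed.

End comonotone.

(** * Directional differentiability on the cube *)

Section directional.
Context {R : realType} {K : nat} (r : 'rV[R]_K -> R).

(** Differentiability along a filter expands the function around the limit of that filter; this
    identifies the base point. *)
Lemma lim_within_nbhs (V : normedModType R) (A : set V) (p : V) :
  A p -> lim (within A (nbhs p)) = p.
Proof.
move=> Ap; have Fp : ProperFilter (within A (nbhs p)).
  by apply: within_nbhs_proper; exact: subset_closure.
have := @cvg_lim V (@norm_hausdorff _ V) V _ Fp id p; apply.
exact: cvg_within.
Qed.

Lemma cube_direction (p v : 'rV[R]_K) (e1 : R) (eta : R) :
  cube p -> differentiable r (within cube (nbhs p)) -> 0 < e1 -> 0 < eta ->
  (forall eps, 0 <= eps <= e1 -> cube (p + eps *: v)) ->
  exists2 e0, 0 < e0 & forall eps, 0 <= eps <= e0 ->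
    `|r (p + eps *: v) - r p - eps * \sum_i v ord0 i * grad r p i| <= eta * eps.
Proof.
move=> cp [[_ dr]] e10 eta0 cv; move: dr; rewrite lim_within_nbhs //.
have nv : 0 < `|v| + 1 by rewrite ltr_wpDl.
have c0 : 0 < eta / (`|v| + 1) by rewrite divr_gt0.
move=> /eqaddoP /(_ _ c0) H.
set F := within_filter_on _ _ in H.
have {H}/nbhs_ballP[d /= d0 H] : nbhs p (fun x => cube x ->
    `|r x - (r p + 'd r F (x - p))| <= eta / (`|v| + 1) * `|x - p|) := H.
(* The bound [e1] keeps the point in the cube, where the remainder is controlled. Halving [d] puts
   it strictly inside the ball, and the added 1 covers [v = 0]. *)
exists (Num.min e1 (d / 2 / (`|v| + 1))); first by rewrite lt_min e10 !divr_gt0.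
move=> eps /andP[eps0]; rewrite le_min => /andP[epse1 epsd].
have epsv0 : 0 <= eps * `|v| by rewrite mulr_ge0.
have inb : ball p d (p + eps *: v).
  rewrite -ball_normE /= opprD addNKr normrN normrZ ger0_norm //.
  rewrite ler_pdivlMr // in epsd; lra.
have := H _ inb (cv _ _); rewrite eps0 epse1 => /(_ isT).
rewrite addrAC subrr add0r linearZ normrZ (ger0_norm eps0) opprD addrA.
have -> : 'd r F v = \sum_i v ord0 i * grad r p i.
  rewrite {1}(row_sum_delta v) linear_sum; apply: eq_bigr => i _.
  by rewrite linearZ.
move=> /le_trans; apply.
rewrite -mulrA ler_wpM2l ?(ltW eta0) // mulrC ler_pdivrMr //.
lra.
Qed.
End directional.

(** * Parameters of the lower bound *)

Section sorted_means.
Context {R : realType} {K : nat}.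
Variables (mu : 'rV[R]_K) (I : {set 'I_K}).

Lemma perm_sorted_means :
  perm_eq (sorted_means mu I) [seq mu ord0 i | i <- enum 'I_K].
Proof.
rewrite /sorted_means.
apply: (@perm_trans _
  ([seq mu ord0 i | i <- enum (~: I)] ++ [seq mu ord0 i | i <- enum I])).
  by rewrite perm_cat2r perm_sort.
rewrite -map_cat; apply: perm_map; apply: uniq_perm.
- rewrite cat_uniq !enum_uniq andbT /=; apply/hasPn => i.
  by rewrite !mem_enum inE => ->.
- exact: enum_uniq.
by move=> i; rewrite mem_cat !mem_enum inE orNb.
Qed.

Lemma size_sorted_means : size (sorted_means mu I) = K.
Proof. by rewrite (perm_size perm_sorted_means) size_map size_enum_ord. Qed.

Lemma sorted_means_permE : exists p : 'S_K,
  forall i : 'I_K, mu ord0 i = (sorted_means mu I)`_(p i).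
Proof.
have szs : size (sorted_means mu I) == K by rewrite size_sorted_means.
have : perm_eq [tuple mu ord0 i | i < K] (Tuple szs).
  by rewrite perm_sym; exact: perm_sorted_means.
case/tuple_permP => p Ep; exists p => i.
have := congr1 (fun t => t`_i) Ep.
by rewrite -!tnth_nth !tnth_mktuple (tnth_nth 0).
Qed.

Lemma sorted_means_unit i : cube mu -> (i < K)%N ->
  0 <= (sorted_means mu I)`_i <= 1.
Proof.
move=> cmu iK; have : (sorted_means mu I)`_i \in sorted_means mu I.
  by rewrite mem_nth // size_sorted_means.
by rewrite (perm_mem perm_sorted_means) => /mapP[j _ ->]; exact: cmu.
Qed.

Lemma sorted_means_le i j : (i <= j < K - #|I|)%N ->
  (sorted_means mu I)`_i <= (sorted_means mu I)`_j.
Proof.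
case/andP=> ij jk; have ik := leq_ltn_trans ij jk.
rewrite /sorted_means !nth_cat size_sort size_map -cardE cardsCs finset.setCK card_ord.
rewrite ik jk; apply: (sorted_leq_nth le_trans lexx) => //.
- exact: (sort_sorted le_total).
- by rewrite inE size_sort size_map -cardE cardsCs finset.setCK card_ord.
- by rewrite inE size_sort size_map -cardE cardsCs finset.setCK card_ord.
Qed.

End sorted_means.

(** The [K - k] shared arms come first, then block [b] takes the [k] numbers from [K - k + b k] on.
    The last block fits because [b k <= m - K]. *)
Lemma block_layout (m K k : nat) : (0 < k <= K)%N -> (K <= m)%N ->
  exists e : 'I_((m - K) %/ k).+1 -> 'I_K -> 'I_m,
    (forall b b' i i', e b i = e b' i' -> i = i' /\ (b = b' \/ (k <= i)%N)) /\
    (forall b b' (i : 'I_K), (k <= i)%N -> e b i = e b' i).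
Proof.
case/andP=> k0 kK Km; set n := ((m - K) %/ k).+1.
pose f (b : 'I_n) (i : 'I_K) : nat :=
  if (i < k)%N then (K - k + b * k + i)%N else (i - k)%N.
have fm b i : (f b i < m)%N.
  rewrite /f; case: ifP => ik; last first.
    by apply: leq_ltn_trans (leq_subr _ _) _; apply: leq_trans Km.
  have : (b * k <= m - K)%N.
    apply: leq_trans (leq_trunc_div (m - K) k); rewrite leq_mul2r.
    by rewrite -ltnS ltn_ord orbT.
  lia.
exists (fun b i => Ordinal (fm b i)); split=> [b b' i i' /(congr1 val) /= E|b b' i ki].
  move: E; rewrite /f; case: (ltnP i k) => ik; case: (ltnP i' k) => ik'.
  - rewrite -!addnA => /addnI E.
    have Ei : nat_of_ord i = i'.
      by have := congr1 (modn^~ k) E; rewrite !modnMDl !modn_small.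
    split; first exact: val_inj.
    left; apply: val_inj; move: E; rewrite Ei => /addIn /eqP.
    by rewrite eqn_pmul2r // => /eqP.
  - have := ltn_ord i'; lia.
  - have := ltn_ord i; lia.
  - by move=> E; split; [apply: val_inj => /=; lia|right].
by apply: val_inj; rewrite /= /f ltnNge ki.
Qed.

(** * Tuning the tilt for a fixed set [I] *)

Section one_coordinate_set.
Context {R : realType} {K m : nat} (r : 'rV[R]_K -> R) (mu : 'rV[R]_K).
Hypotheses (hr : smooth_index_invariant r) (hmu : cube mu).
Hypothesis hm : (3 * K <= m)%N.
Variable I : {set 'I_K}.
Hypothesis I_proper : I \proper [set: 'I_K]%SET.

Let k := (K - #|I|)%N.
Let s := sorted_means mu I.
Let p := sorted_vec mu I.
Let g := grad r p.
Let P := @como_weight R k s.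
Let score := @como_score R K k s g.
Let n := ((m - K) %/ k).+1.
Let s_max := \sum_y `|score y|.

Let k0 : (0 < k)%N.
Proof. by rewrite /k subn_gt0; have := proper_card I_proper; rewrite cardsT card_ord. Qed.

Let kK : (k <= K)%N. Proof. exact: leq_subr. Qed.

Let Km : (K <= m)%N. Proof. lia. Qed.

Let s_unit i : (i < K)%N -> 0 <= s`_i <= 1.
Proof. exact: sorted_means_unit. Qed.

Let s_sorted i j : (i <= j < k)%N -> s`_i <= s`_j.
Proof. exact: sorted_means_le. Qed.

Let P0 y : 0 <= P y. Proof. exact: (como_weight_ge0 s_unit s_sorted kK). Qed.

Let P1 : \sum_y P y = 1. Proof. exact: sum_como_weight. Qed.

Let score_le y : `|score y| <= s_max.
Proof. by rewrite /s_max (bigD1 y) //= lerDl sumr_ge0. Qed.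

Let s_max0 : 0 <= s_max. Proof. exact: sumr_ge0. Qed.

Let n_ge : 3 <= n%:R :> R.
Proof. by rewrite (ler_nat R 3) /n ltnS leq_divRL //; lia. Qed.

(** The extra block makes up for the rounding, so no constant is lost. *)
Let n_ge_ratio : (m - K)%:R / k%:R <= n%:R :> R.
Proof.
rewrite ler_pdivrMr ?ltr0n // -natrM ler_nat ltnW // -ltn_divLR //.
Qed.

Let varE : \sum_y P y * score y ^+ 2 = gini_sq r mu I.
Proof.
rewrite como_varE //; rewrite /gini_sq /= -/k; congr (_ + 2 * _).
  by apply: eq_bigr => i _; rewrite mxE.
by apply: eq_bigr => i _; apply: eq_bigr => j _; rewrite !mxE.
Qed.

Let gini_sq_ge0 : 0 <= gini_sq r mu I.
Proof. by rewrite -varE; apply: sumr_ge0 => y _; rewrite mulr_ge0 ?sqr_ge0. Qed.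

Let gap eps := r p - r (p + eps *: como_drift k s g).

Let small_score eps : 0 <= eps -> eps * (s_max + 1) <= 10^-1 ->
  forall y, - 10^-1 <= eps * score y <= 10^-1.
Proof.
move=> e0 es y; rewrite -ler_norml normrM ger0_norm //.
apply: le_trans es; apply: ler_wpM2l => //; have := score_le y; lra.
Qed.

Lemma tilted_regret eps T (psi : strategy R m K) :
  0 <= eps -> eps * (s_max + 1) <= 10^-1 -> 0 <= gap eps ->
  let B := gap eps * T%:R * (1 - n%:R^-1 -
    2 * (3 / 4 * eps ^+ 2 * gini_sq r mu I) * T%:R / n%:R - 4^-1) in
  0 <= B ->
  exists (nu : cmab R m K) (Sopt J : {set 'I_m}),
    [/\ J_disjoint nu J, optimal r nu Sopt, has_means nu Sopt mu
      & (B%:E <= expected_regret r nu psi Sopt T)%E].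
Proof.
move=> eps0 epss gap0 B B0.
have [e [e_inj e_common]] := block_layout (k := k) (introT andP (conj k0 kK)) Km.
have small := small_score eps0 epss.
(* The optimal block keeps the law [P] with means exactly [p]; the others are tilted. Since the
   reference law is [Q], the ratio [L] is the inverse of the tilt. *)
pose Q y := P y * (1 - eps * score y).
pose L y := (1 - eps * score y)^-1.
have pos y : 0 < 1 - eps * score y by have := small y; lra.
have Q0 y : 0 <= Q y by rewrite mulr_ge0 // ltW.
have Q1 : \sum_y Q y = 1.
  under eq_bigr do rewrite /Q mulrBr mulr1 mulrCA.
  by rewrite sumrB P1 -big_distrr /= como_score_mean // mulr0 subr0.
have PE y : P y = Q y * L y by rewrite /Q /L mulfK // lt0r_neq0.
have Lge y : 8 / 9 <= L y.
  rewrite /L -[X in X <= _]invrK lef_pV2 ?posrE ?invr_gt0 //.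
  have := small y; lra.
(* From [|eps * score| <= 1/10] follows [L <= 10/9], and [2/3 * 10/9 = 20/27] is below [3/4]. *)
have kappaE : 2 / 3 * \sum_y Q y * (L y - 1) ^+ 2 <=
    3 / 4 * eps ^+ 2 * gini_sq r mu I.
  rewrite -varE !big_distrr /=; apply: ler_sum => y _.
  have -> : Q y * (L y - 1) ^+ 2 = P y * (eps * score y) ^+ 2 * L y.
    by rewrite /Q /L; field; rewrite lt0r_neq0.
  have L2 : L y <= 10 / 9.
    rewrite /L -[X in _ <= X]invrK lef_pV2 ?posrE //.
    have := small y; lra.
  have h0 : 0 <= P y * (eps * score y) ^+ 2 by rewrite mulr_ge0 ?sqr_ge0.
  have := ler_wpM2l h0 L2.
  have -> : 3 / 4 * eps ^+ 2 * (P y * score y ^+ 2) =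
    3 / 4 * (P y * (eps * score y) ^+ 2) by ring.
  lra.
pose X := como_arms (K := K) (k := k) s.
have X_cube y : cube (X y) by exact: como_arms_cube.
have X_cst y y' (i : 'I_K) : (k <= i)%N -> X y ord0 i = X y' ord0 i.
  by move=> ki; rewrite !mxE ltnNge ki.
have means_opt (a : 'I_n) : block_means X P Q a a = p.
  apply/rowP => i; rewrite summxE [RHS]mxE -(como_mean k s).
  by apply: eq_bigr => y _; rewrite mxE /block_weight eqxx.
have means_sub (a b : 'I_n) : b != a ->
    block_means X P Q a b = p + eps *: como_drift k s g.
  move=> /negPf ba; rewrite -[RHS](tilted_mean k).
  by apply: eq_bigr => y _; rewrite /block_weight ba.
have gapE (a b : 'I_n) : b != a ->
    r (block_means X P Q a a) - r (block_means X P Q a b) = gap eps.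
  by move=> ba; rewrite means_opt means_sub.
have [a Ba] := env_regret ord0 ord0 e_inj X_cube X_cst
  P0 P1 Q0 Q1 hr gap0 gapE psi PE Lge kappaE B0.
eexists _, _, _; split; last exact: Ba.
- exact: env_J_disjoint.
- exact: (optimal_block _ _ _ _ _ _ _ _ _ hr gap0 gapE).
(* The block carries the sorted means; [q] restores the order of [mu]. *)
have [q qE] := sorted_means_permE mu I.
exists (fun i => e a (q i)); split.
- by move=> i j /e_inj[/perm_inj].
- apply/setP => j; apply/imsetP/imsetP => -[i _ ->].
    by exists (q i).
  by exists ((q^-1)%g i); rewrite ?permKV.
- by move=> i; rewrite arm_mean_env // means_opt mxE qE.
Qed.

Lemma gini_regret : exists T0 : nat, forall T : nat, (T0 <= T)%N ->
  forall psi : strategy R m K,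
  exists (nu : cmab R m K) (Sopt J : {set 'I_m}),
    [/\ J_disjoint nu J, optimal r nu Sopt, has_means nu Sopt mu
      & ((gini r mu I / 32 * Num.sqrt (T%:R * (m - K)%:R / k%:R))%:E
         <= expected_regret r nu psi Sopt T)%E].
Proof.
have p_cube : cube p by move=> i; rewrite mxE; exact: s_unit.
(* In the degenerate case the bound is 0, and [eps = 0] makes all blocks equally good. *)
have [g0|gn0] := eqVneq (gini r mu I) 0.
  exists 0 => T _ psi.
  have := @tilted_regret 0 T psi (lexx 0).
  rewrite /gap mul0r scale0r addr0 subrr !mul0r invr_ge0 lexx g0 !mul0r.
  by apply.
have g_gt0 : 0 < gini r mu I by rewrite lt_neqAle eq_sym gn0 sqrtr_ge0.
have gE : gini r mu I ^+ 2 = gini_sq r mu I by rewrite sqr_sqrtr.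
have sm : 0 < 10^-1 / (s_max + 1) by rewrite divr_gt0 ?ltr_wpDl.
(* The first-order gap is [eps * gini_sq]; this tolerance gives up at most half of it. *)
have [e0 e00 He0] : exists2 e0, 0 < e0 & forall eps, 0 <= eps <= e0 ->
    `|r (p + eps *: como_drift k s g) - r p -
      eps * \sum_i como_drift k s g ord0 i * grad r p i| <=
    gini_sq r mu I / 2 * eps.
  apply: (@cube_direction R K r p _ (10^-1 / (s_max + 1))) => //.
  - by case: hr => + _; apply.
  - by rewrite divr_gt0 // -gE exprn_gt0.
  move=> eps /andP[eps0]; rewrite ler_pdivlMr ?ltr_wpDl // => epss i.
  have small := small_score eps0 epss.
  rewrite -[p + _](tilted_mean k) summxE.
  have E y : 0 <= P y * (1 - eps * score y).
    by rewrite mulr_ge0 //; have := small y; lra.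
  apply/andP; split.
    apply: sumr_ge0 => y _; rewrite mxE mulr_ge0 //.
    by have /andP[] := como_arms_cube s_unit y i.
  apply: (@le_trans _ _ (\sum_y P y * (1 - eps * score y))).
    apply: ler_sum => y _; rewrite mxE ler_piMr //.
    by have /andP[] := como_arms_cube s_unit y i.
  under eq_bigr do rewrite mulrBr mulr1 mulrCA.
  by rewrite sumrB P1 -big_distrr /= como_score_mean // mulr0 subr0.
have gap_ge eps : 0 <= eps <= e0 -> eps * gini_sq r mu I / 2 <= gap eps.
  move=> /He0; rewrite sum_grad_drift // varE /gap ler_norml => /andP[_].
  lra.
pose e1 := Num.min e0 (10^-1 / (s_max + 1)).
have e10 : 0 < e1 by rewrite lt_min e00.
(* The condition [C <= T] is equivalent to [eps <= e1] for the [eps] chosen below. *)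
pose C := n%:R / (4 * gini r mu I * e1) ^+ 2.
have C0 : 0 <= C by rewrite divr_ge0 ?sqr_ge0.
exists (Num.bound C).+1 => T T0T psi.
have CT : C <= T%:R.
  apply: ltW; apply: lt_le_trans (archi_boundP C0) _.
  by rewrite ler_nat ltnW.
have T_gt0 : 0 < T%:R :> R by rewrite ltr0n (leq_ltn_trans _ T0T).
have n_gt0 : 0 < n%:R :> R by rewrite ltr0n.
pose a : R := Num.sqrt (n%:R / T%:R).
have a0 : 0 <= a by exact: sqrtr_ge0.
have a2 : a ^+ 2 = n%:R / T%:R by rewrite sqr_sqrtr // divr_ge0.
(* With n the number of blocks, this choice [eps = sqrt (n / T) / (4 gini)]
   balances the gap, about [eps gini^2], with the information
   [eps^2 gini^2 T / n] available per block. *)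
pose eps := a / (4 * gini r mu I).
have eps0 : 0 <= eps by rewrite divr_ge0 // mulr_ge0 // ltW.
have epse1 : eps <= e1.
  have d0 : 0 < 4 * gini r mu I * e1 by rewrite !mulr_gt0.
  rewrite ler_pdivrMr ?mulr_gt0 // [e1 * _]mulrC -ler_sqr ?nnegrE ?(ltW d0) //.
  rewrite a2 ler_pdivrMr // [_ * T%:R]mulrC -ler_pdivrMr //.
  by rewrite exprn_gt0.
have epss : eps * (s_max + 1) <= 10^-1.
  rewrite -ler_pdivlMr ?ltr_wpDl //; apply: le_trans epse1 _.
  by rewrite /e1 ge_min lexx orbT.
have gapeps : eps * gini_sq r mu I / 2 <= gap eps.
  by apply: gap_ge; rewrite eps0 (le_trans epse1) // /e1 ge_min lexx.
have epsV : eps ^+ 2 * gini_sq r mu I * T%:R / n%:R = 16^-1.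
  rewrite -gE /eps expr_div_n a2; field.
  by rewrite !lt0r_neq0.
have epsV1 : eps * gini_sq r mu I = a * gini r mu I / 4.
  by rewrite -gE /eps; field.
have gap0 : 0 <= gap eps.
  by apply: le_trans gapeps; rewrite epsV1; rewrite !divr_ge0 ?mulr_ge0 // ltW.
have n3 : n%:R^-1 <= 3^-1 :> R by rewrite lef_pV2 ?posrE.
pose Bd : R := 1 - n%:R^-1 - 2 * (3 / 4 * eps ^+ 2 * gini_sq r mu I) * T%:R / n%:R - 4^-1.
(* With [n >= 3] the value is at least [1 - 1/3 - 3/32 - 1/4 = 31/96]. *)
have Bd_ge : 1 / 4 <= Bd.
  have -> : Bd = 1 - n%:R^-1 - 3 / 2 * (eps ^+ 2 * gini_sq r mu I * T%:R / n%:R) - 4^-1.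
    by rewrite /Bd; field; rewrite lt0r_neq0.
  rewrite epsV; lra.
have := tilted_regret psi eps0 epss gap0 (T := T); rewrite /= -/Bd.
have B0 : 0 <= gap eps * T%:R * Bd by rewrite !mulr_ge0 // ?ltW //; lra.
move=> /(_ B0)[nu [Sopt [J [H1 H2 H3 H4]]]].
exists nu, Sopt, J; split=> //; apply: le_trans H4; rewrite lee_fin.
have sq_le : Num.sqrt (T%:R * (m - K)%:R / k%:R) <= T%:R * a.
  rewrite -[X in _ <= X]ger0_norm ?mulr_ge0 // -sqrtr_sqr ler_sqrt ?sqr_ge0 //.
  have -> : (T%:R * a) ^+ 2 = T%:R * n%:R.
    by rewrite exprMn a2; field; rewrite lt0r_neq0.
  by rewrite -mulrA ler_pM2l.
apply: (@le_trans _ _ (gini r mu I / 32 * (T%:R * a))).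
  by rewrite ler_wpM2l // divr_ge0 // ltW.
(* The constant 32 is 4 from [eps], 2 from the halved gap and 4 from [Bd]. *)
have -> : gini r mu I / 32 * (T%:R * a) = a * gini r mu I / 4 / 2 * T%:R * (1 / 4).
  by field.
rewrite ler_pM ?ler_pM // ?mulr_ge0 ?invr_ge0 //; try exact: ltW.
by rewrite -epsV1.
Qed.

End one_coordinate_set.

Theorem theorem2 (R : realType) (K m : nat) (hK : (1 <= K)%N)
    (hm : (3 * K <= m)%N) (r : 'rV[R]_K -> R)
    (hr : smooth_index_invariant r) (mu : 'rV[R]_K) (hmu : cube mu) :
  exists T0 : nat, forall T : nat, (T0 <= T)%N ->
  forall psi : strategy R m K,
  exists (nu : cmab R m K) (Sopt J : {set 'I_m}),
    [/\ J_disjoint nu J, optimal r nu Sopt, has_means nu Sopt mu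
      & ((\big[Num.max/0]_(I : {set 'I_K} | I \proper [set: 'I_K]%SET)
            (gini r mu I / 32 *
             Num.sqrt (T%:R * (m - K)%:R / (K - #|I|)%:R)))%:E
         <= expected_regret r nu psi Sopt T)%E].
Proof.
pose spec (I : {set 'I_K}) T0 := forall T : nat, (T0 <= T)%N ->
  forall psi : strategy R m K,
  exists (nu : cmab R m K) (Sopt J : {set 'I_m}),
    [/\ J_disjoint nu J, optimal r nu Sopt, has_means nu Sopt mu
      & ((gini r mu I / 32 * Num.sqrt (T%:R * (m - K)%:R / (K - #|I|)%:R))%:E
         <= expected_regret r nu psi Sopt T)%E].
have /choice[T0 T0P] : forall I : {set 'I_K},
    exists T0, I \proper [set: 'I_K]%SET -> spec I T0.
  move=> I; have [Ip|] := boolP (I \proper [set: 'I_K]%SET); last by exists 0.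
  by have [T0 ?] := gini_regret hr hmu hm Ip; exists T0.
(* The problem of a set [I] that attains the maximum will serve; the horizon must be large enough
   for every candidate. *)
exists (\max_I T0 I)%N => T leT psi.
(* As [K >= 1], the empty set is admissible, so the maximum is one of its terms and not just the
   default 0. *)
have Ip : finset.set0 \proper [set: 'I_K]%SET.
  by rewrite properEcard finset.sub0set cards0 cardsT card_ord.
rewrite (@bigmax_eq_arg _ _ _ 0 finset.set0) //; last first.
  by move=> I _; rewrite !mulr_ge0 ?sqrtr_ge0.
case: arg_maxP => // I HI _.
by apply: T0P => //; apply: leq_trans leT; exact: leq_bigmax.
Qed.
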